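(* For every $k>1$, there exists a real Banach space with a $k$-unconditional basis whose closed unit ball is not slicely countably determined (SCD).
   Context: $k$-unconditional basis ($k\ge1$): a Schauder basis $(e_j)_{j=1}^\infty$ of a Banach space such that for every $N\in\mathbb N$ and all scalars $a_1,\dots,a_N,b_1,\dots,b_N$ with $|a_j|\le|b_j|$ for all $j$, one has $\left\|\sum_{j=1}^N a_je_j\right\|\le k\left\|\sum_{j=1}^N b_je_j\right\|$. Let $A$ be a bounded subset of a Banach space $X$. A slice of $A$ is a nonempty set of the form $S(A,x^*,\alpha)=\{x\in A:\operatorname{Re}x^*(x)>\sup_{a\in A}\operatorname{Re}x^*(a)-\alpha\}$ with $x^*\in X^*\setminus\{0\}$ and $\alpha>0$. $A$ is slicely countably determined (SCD) if there exists a sequence $(S_n)_{n=1}^\infty$ of slices of $A$ such that, whenever $B\subset A$ intersects every $S_n$, one has $A\subset\overline{\operatorname{conv}}(B)$. *)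

(* Defs.v *)
From HB Require Import structures.
From mathcomp Require Import all_boot all_order all_algebra.
From mathcomp Require Import all_classical all_reals all_analysis.

Set Implicit Arguments.
Unset Strict Implicit.
Unset Printing Implicit Defensive.

Import Order.TTheory GRing.Theory Num.Theory.
Import numFieldNormedType.Exports.

Local Open Scope classical_set_scope.
Local Open Scope ring_scope.

(* Real Banach spaces are completeNormedModType's over R : realType; indices of
   sequences start at 0. *)

Section Definitions.
Context {R : realType} {X : completeNormedModType R}.
Implicit Types (A B S : set X) (e : X ^nat).

Definition schauder_basis e : Prop :=
  forall x : X, exists! a : R ^nat,
    series (fun j => a j *: e j) n @[n --> \oo] --> x.

Definition unconditional_basis (k : R) e : Prop :=
  schauder_basis e /\
  forall (N : nat) (a b : R ^nat),
    (forall j, (j < N)%N -> `|a j| <= `|b j|) ->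
    `|\sum_(j < N) a j *: e j| <= k * `|\sum_(j < N) b j *: e j|.

(* [sup] is the real supremum, with a default value on sets having none: [slice]
   and the notions below are only meaningful for bounded A. *)
Definition slice A (f : {linear X -> R^o}) (alpha : R) : set X :=
  [set x | A x /\ sup [set f a | a in A] - alpha < f x].

Definition is_slice A S : Prop :=
  S !=set0 /\
  exists (f : {linear X -> R^o}) (alpha : R),
    [/\ continuous f, exists x, f x != 0, 0 < alpha & S = slice A f alpha].

Definition convex_hull B : set X := smallest (@convex_set R X) B.

Definition SCD A : Prop :=
  exists S : (set X) ^nat,
    (forall n, is_slice A (S n)) /\
    forall B, B `<=` A -> (forall n, B `&` S n !=set0) ->
      A `<=` closure (convex_hull B).

End Definitions.

Definition closed_unit_ball {R : realType} (X : completeNormedModType R) :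
  set X := [set x | `|x| <= 1].
Arguments closed_unit_ball {R} X _.

(* Main.v *)
From HB Require Import structures.
Require Import Defs.
From mathcomp Require Import all_boot all_order all_algebra.
From mathcomp Require Import all_classical all_reals all_analysis.
From mathcomp Require Import ring lra.

Set Implicit Arguments.
Unset Strict Implicit.
Unset Printing Implicit Defensive.

Import Order.TTheory GRing.Theory Num.Theory.
Import numFieldNormedType.Exports.

Local Open Scope classical_set_scope.
Local Open Scope ring_scope.

(** Fix an enumeration of the tree omega^{<omega} by the naturals in which every
    node follows its parent, let eps = k - 1, and let X be the completion of the
    finitely supported sequences for the norm whose dual ball G consists of the
    functionals bounded by 1 on the following atoms: the vectors
    +- (e_0 + eps (e_{s_1} + .. + e_{s_m})), where s_1, .., s_m = t is the branch
    from the root 0 (excluded) to the node t, and the sequences with entries in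
    [-1, 1] supported by such a branch or by the children of a single node.

    Multiplying g in G by signs or smaller scalars only affects the bound on the
    first kind of atoms, which becomes 1 + eps = k: the basis is
    k-unconditional.  The atoms being stable under truncation, (e_j) is even
    monotone.

    Every slice of the unit ball contains a truncated atom, since a functional
    bounded by 1 on the atoms lies in G.  The point e_0 is not in the closed
    convex hull of a well-chosen selection of atoms: if the atom picked from the
    n-th slice is of the form e_0 + eps (..) for a node t, then either t is
    already above one of the nodes chosen before, or, the children of a node
    spanning a copy of c_0, the slice also contains the vector of a grandchild a
    of t with arbitrarily large index, and a is chosen.  The set A of chosen
    nodes is an antichain with distinct parents, hence
    sum_{a in A} e_a^* - (1 + eps) e_0^* is continuous; it is at least -1 on all
    the selected vectors, and equal to -(1 + eps) at e_0. *)

(** * Spaces with a prescribed dual ball *)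

Section Pairing.
Context {R : realType}.
Implicit Types (g x y : nat -> R^o) (c : R) (m n : nat).

Definition pairing g x n : R := \sum_(j < n) g j * x j.

Definition head m x : nat -> R^o := fun j => if (j < m)%N then x j else 0.

Definition delta m : nat -> R^o := fun j => (j == m)%:R.

Lemma pairing0r g n : pairing g 0 n = 0.
Proof. by rewrite /pairing big1// => j _; rewrite mulr0. Qed.

Lemma pairingDr g x y n : pairing g (x + y) n = pairing g x n + pairing g y n.
Proof. by rewrite /pairing -big_split; apply: eq_bigr => j _; rewrite mulrDr. Qed.

Lemma pairingZr g c x n : pairing g (c *: x) n = c * pairing g x n.
Proof. by rewrite /pairing mulr_sumr; apply: eq_bigr => j _; rewrite mulrCA. Qed.

Lemma pairingNr g x n : pairing g (- x) n = - pairing g x n.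
Proof. by rewrite -scaleN1r pairingZr mulN1r. Qed.

Lemma pairingBr g x y n : pairing g (x - y) n = pairing g x n - pairing g y n.
Proof. by rewrite pairingDr pairingNr. Qed.

Lemma pairingZl g c x n : pairing (c *: g) x n = c * pairing g x n.
Proof. by rewrite /pairing mulr_sumr; apply: eq_bigr => j _; rewrite mulrA. Qed.

Lemma pairing_headl g x m n : pairing (head m g) x n = pairing g x (minn m n).
Proof.
rewrite /pairing /head; elim: n => [|n IH].
  by rewrite minn0 !big_ord0.
rewrite big_ord_recr/= IH; case: (ltnP n m) => nm.
  have -> : minn m n.+1 = n.+1 by apply/minn_idPr.
  by rewrite big_ord_recr.
rewrite mul0r addr0.
by rewrite (minn_idPl (leqW nm)).
Qed.

Lemma pairing_headr g x m n : pairing g (head m x) n = pairing g x (minn m n).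
Proof.
rewrite -pairing_headl; apply: eq_bigr => j _; rewrite /head.
by case: ifP; rewrite ?mulr0 ?mul0r.
Qed.

Lemma headD m x y : head m (x + y) = head m x + head m y.
Proof.
by apply/funext => j; rewrite !fctE /head; case: ifP; rewrite ?addr0.
Qed.

Lemma headB m x y : head m (x - y) = head m x - head m y.
Proof.
by apply/funext => j; rewrite !fctE /head; case: ifP; rewrite ?subr0.
Qed.

Lemma headZ m c x : head m (c *: x) = c *: head m x.
Proof.
by apply/funext => j; rewrite !fctE /head; case: ifP => _; rewrite ?scaler0.
Qed.

Lemma headN n u : head n (- u) = - head n u.
Proof. by rewrite -scaleN1r headZ scaleN1r. Qed.

Lemma head_delta n m : head n (delta m) = if (m < n)%N then delta m else 0
  :> (nat -> R^o).
Proof.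
apply/funext => j; rewrite /head /delta; have [->|jm] := eqVneq j m.
  by case: ifP; rewrite ?eqxx.
by case: ifP; case: ifP; rewrite ?(negPf jm).
Qed.

Lemma pairing_deltal m x n : pairing (delta m) x n = if (m < n)%N then x m else 0.
Proof.
case: ifP => mn.
  rewrite /pairing (bigD1 (Ordinal mn))//= big1 ?addr0 => [|j].
    by rewrite /delta eqxx mul1r.
  by rewrite -val_eqE /delta => /negPf /= ->; rewrite mul0r.
rewrite /pairing big1// => j _; rewrite /delta ltn_eqF ?mul0r//.
by rewrite (leq_trans (ltn_ord j))// leqNgt mn.
Qed.

Lemma pairing_deltar g m n : pairing g (delta m) n = if (m < n)%N then g m else 0.
Proof.
by rewrite -pairing_deltal; apply: eq_bigr => j _; rewrite mulrC.
Qed.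

Lemma pairing_mull g x y n :
  pairing (fun j => x j * g j) y n = pairing g (fun j => x j * y j) n.
Proof. by apply: eq_bigr => j _; rewrite mulrA (mulrC (g j)). Qed.

End Pairing.

Record atoms (R : realType) := Atoms {
  atom : set (nat -> R^o);
  atom_bound : R;
  atom_le : forall u j, atom u -> `|u j| <= atom_bound;
  atom_delta : forall m, atom (delta m);
  atom_head : forall u m, atom u -> atom (head m u) }.

Section AtomicSpace.
Context {R : realType} (K : atoms R).
Implicit Types (g x y : nat -> R^o) (c : R) (m n : nat).

(** The condition bears on partial sums, so atoms of infinite support raise no question of
    convergence and [polar] is stable under [head]. *)
Definition polar : set (nat -> R^o) :=
  [set g | forall u n, atom K u -> `|pairing g u n| <= 1].

Lemma atom_bound_gt0 : 0 < atom_bound K.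
Proof.
apply: lt_le_trans (atom_le 0%N (atom_delta K 0)).
by rewrite /delta eqxx normr1.
Qed.

(** Coordinates of atoms are bounded by [atom_bound K]; this is what makes the coordinates of the
    space continuous. *)
Lemma polar_delta m : polar ((atom_bound K)^-1 *: delta m).
Proof.
move=> u n Ku; rewrite pairingZl normrM gtr0_norm ?invr_gt0 ?atom_bound_gt0//.
rewrite mulrC ler_pdivrMr ?atom_bound_gt0// mul1r pairing_deltal.
by case: ifP; rewrite ?atom_le// normr0 ltW// atom_bound_gt0.
Qed.

Lemma polar_coord g m : polar g -> `|g m| <= 1.
Proof.
by move=> /(_ _ m.+1 (atom_delta K m)); rewrite pairing_deltar ltnSn.
Qed.

Lemma polar_head g m : polar g -> polar (head m g).
Proof. by move=> Gg u n Ku; rewrite pairing_headl; exact: Gg. Qed.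

Lemma polar_pairing_bounded x n :
  exists M : R, forall g, polar g -> `|pairing g x n| <= M.
Proof.
exists (\sum_(j < n) `|x j|) => g Gg.
rewrite (le_trans (ler_norm_sum _ _ _))//; apply: ler_sum => j _.
by rewrite normrM ler_piMl// polar_coord.
Qed.

(** Tails vanish uniformly over [polar]: this realizes the completion of the finitely supported
    sequences by concrete sequences. *)
Definition small_tails x : Prop :=
  forall d : R, 0 < d -> exists N : nat, forall g m n, polar g -> (N <= m)%N ->
    `|pairing g (x - head m x) n| <= d.

Definition small_tailsb : {pred nat -> R^o} := fun x => `[< small_tails x >].

Lemma small_tails_submod : submod_closed small_tailsb.
Proof.
split=> [|c x y /asboolP tx /asboolP ty]; apply/asboolP.
  move=> d d0; exists 0%N => g m n _ _.
  rewrite (_ : 0 - _ = 0) ?pairing0r ?normr0 ?(ltW d0)//.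
  by apply/funext => j; rewrite /= !fctE /head; case: ifP; rewrite subrr.
(* Dividing by [|c| + 1] rather than [|c|] covers [c = 0]. *)
move=> d d0; have c0 : 0 < `|c| + 1 by rewrite ltr_wpDl.
have [N1 h1] := tx (d / 2 / (`|c| + 1)) ltac:(by rewrite !divr_gt0).
have [N2 h2] := ty (d / 2) ltac:(by rewrite !divr_gt0).
exists (maxn N1 N2) => g m n Gg; rewrite geq_max => /andP[m1 m2].
rewrite headD headZ opprD addrACA -scalerN -scalerDr pairingDr pairingZr.
rewrite (le_trans (ler_normD _ _))// [leRHS](splitr d) lerD ?h2// normrM.
have := h1 g m n Gg m1; rewrite ler_pdivlMr// mulrC; apply: le_trans.
by rewrite ler_wpM2r// lerDl.
Qed.

HB.instance Definition _ :=
  GRing.isSubmodClosed.Build R (nat -> R^o) small_tailsb small_tails_submod.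

Record space := Space { seq_of : nat -> R^o; _ : seq_of \in small_tailsb }.

HB.instance Definition _ := [isSub for seq_of].
HB.instance Definition _ := [Choice of space by <:].
HB.instance Definition _ := [SubChoice_isSubLmodule of space by <:].


Implicit Types v w : space.

Lemma small_tailsP v : small_tails (seq_of v).
Proof. by case: v => x /= /asboolP. Qed.

Lemma seq_ofD v w : seq_of (v + w) = seq_of v + seq_of w.
Proof. by rewrite -[seq_of]/(\val) raddfD. Qed.

Lemma seq_ofB v w : seq_of (v - w) = seq_of v - seq_of w.
Proof. by rewrite -[seq_of]/(\val) raddfB. Qed.

Lemma seq_ofZ c v : seq_of (c *: v) = c *: seq_of v.
Proof. by rewrite -[seq_of]/(\val) linearZ. Qed.

Definition pairing_values v : set R :=
  [set r | exists g n, polar g /\ r = `|pairing g (seq_of v) n|].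

Definition norm v : R := sup (pairing_values v).

(** The tail beyond a suitable [N] contributes at most 1, and the first [N] terms are bounded
    because elements of [polar] have coordinates bounded by 1. *)
Lemma pairing_values_has_sup v : has_sup (pairing_values v).
Proof.
split.
  exists 0, ((atom_bound K)^-1 *: delta 0), 0%N; split; first exact: polar_delta.
  by rewrite /pairing big_ord0 normr0.
have [N hN] := small_tailsP v ltr01.
have [M hM] := polar_pairing_bounded (seq_of v) N.
exists (1 + M) => _ [g [n [Gg ->]]].
rewrite -[seq_of v](subrK (head N (seq_of v))) pairingDr.
rewrite (le_trans (ler_normD _ _))// lerD ?hN//.
by rewrite pairing_headr minnC -pairing_headl hM//; exact: polar_head.
Qed.

Lemma le_norm v g n : polar g -> `|pairing g (seq_of v) n| <= norm v.
Proof.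
move=> Gg; apply: sup_upper_bound; first exact: pairing_values_has_sup.
by exists g, n.
Qed.

Lemma norm_le v c :
  (forall g n, polar g -> `|pairing g (seq_of v) n| <= c) -> norm v <= c.
Proof.
move=> vc; apply: ge_sup; first by case: (pairing_values_has_sup v).
by move=> _ [g [n [Gg ->]]]; exact: vc.
Qed.

Lemma norm_ge0 v : 0 <= norm v.
Proof. exact: le_trans (le_norm v 0 (polar_delta 0)). Qed.

Lemma coord_le_norm v j : `|seq_of v j| <= atom_bound K * norm v.
Proof.
have := le_norm v j.+1 (polar_delta j).
rewrite pairingZl pairing_deltal ltnSn normrM gtr0_norm ?invr_gt0 ?atom_bound_gt0//.
by rewrite ler_pdivrMl// atom_bound_gt0.
Qed.

Lemma normD_le v w : norm (v + w) <= norm v + norm w.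
Proof.
apply: norm_le => g n Gg; rewrite seq_ofD pairingDr.
by rewrite (le_trans (ler_normD _ _))// lerD// le_norm.
Qed.

Lemma normZ_le c v : norm (c *: v) <= `|c| * norm v.
Proof.
apply: norm_le => g n Gg; rewrite seq_ofZ pairingZr normrM.
by rewrite ler_wpM2l// le_norm.
Qed.

Lemma normZ c v : norm (c *: v) = `|c| * norm v.
Proof.
apply/eqP; rewrite eq_le normZ_le/=.
have [->|c0] := eqVneq c 0; first by rewrite normr0 mul0r norm_ge0.
rewrite -[X in _ * norm X <= _](scalerK c0) -ler_pdivlMl ?normr_gt0// -normfV.
exact: normZ_le.
Qed.

Lemma norm0_eq0 v : norm v = 0 -> v = 0.
Proof.
move=> v0; apply/val_inj; rewrite raddf0; apply/funext => j.
by have := coord_le_norm v j; rewrite v0 mulr0 normr_le0 => /eqP.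
Qed.

HB.instance Definition _ :=
  Lmodule_isNormed.Build R space normD_le normZ norm0_eq0.

Lemma normE v : `|v| = norm v. Proof. by []. Qed.

(** * Completeness, by coordinatewise limits *)

Lemma coord_cauchy (F : set_system space) j : ProperFilter F -> cauchy F ->
  cauchy (seq_of v j @[v --> F]).
Proof.
move=> FF /cauchyP Fc.
apply/cauchyP => _/posnumP[e].
have [v hv] := Fc _ (divr_gt0 (gt0 e) atom_bound_gt0).
exists (seq_of v j).
suff : F [set w | ball (seq_of v j) e%:num (seq_of w j)] by [].
apply: filterS hv => w.
rewrite -!ball_normE/= ltr_pdivlMr ?atom_bound_gt0// mulrC; apply: le_lt_trans.
by have := coord_le_norm (v - w) j; rewrite seq_ofB.
Qed.

(** A pairing is a finite sum, so the bound valid for all points of the ball passes to the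
    coordinatewise limit, uniformly in [g] and [n]. *)
Lemma pairing_limit (F : set_system space) (l : nat -> R^o) g v n (e : R) :
  ProperFilter F -> (forall j, seq_of w j @[w --> F] --> l j) ->
  F (ball v e) -> polar g -> `|pairing g (l - seq_of v) n| <= e.
Proof.
move=> FF Fl Fv Gg; rewrite pairingBr.
have Fg : pairing g (seq_of w) n @[w --> F] --> pairing g l n.
  rewrite /pairing; apply: cvg_big => [|j _]; first exact: add_continuous.
  by apply: cvgM; [exact: cvg_cst|exact: Fl].
apply: (cvgr_to_le (cvg_norm (cvgB Fg (cvg_cst (pairing g (seq_of v) n))))).
apply: filterS Fv => w.
rewrite -ball_normE/= !fctE -pairingBr -seq_ofB -opprB => /ltW; apply: le_trans.
by rewrite normrN; exact: le_norm.
Qed.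

(** A tail of [l] is a tail of [l - seq_of v] plus a tail of [v]. The former is a difference of two
    pairings bounded by [d / 4], the latter is at most [d / 4]. *)
Lemma limit_small_tails (F : set_system space) (l : nat -> R^o) :
  ProperFilter F -> cauchy F -> (forall j, seq_of v j @[v --> F] --> l j) ->
  small_tails l.
Proof.
move=> FF /cauchyP Fc Fl d d0.
have [v Fv] := Fc (d / 4) ltac:(by rewrite divr_gt0).
have [N hN] := small_tailsP v (ltac:(by rewrite divr_gt0) : 0 < d / 4).
exists N => g m n Gg Nm.
have -> : l - head m l =
    (l - seq_of v) - head m (l - seq_of v) + (seq_of v - head m (seq_of v)).
  by rewrite headB opprB addrAC !subrKA.
rewrite pairingDr pairingBr pairing_headr.
have h1 := pairing_limit n FF Fl Fv Gg.
have h2 := pairing_limit (minn m n) FF Fl Fv Gg.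
have h3 := hN g m n Gg Nm.
rewrite (le_trans (ler_normD _ _))//.
have := ler_normB (pairing g (l - seq_of v) n)
  (pairing g (l - seq_of v) (minn m n)).
lra.
Qed.

Lemma space_complete (F : set_system space) :
  ProperFilter F -> cauchy F -> cvg F.
Proof.
move=> FF Fc; pose l j := lim (seq_of v j @[v --> F]).
have Fl j : seq_of v j @[v --> F] --> l j.
  by apply: R_complete; exact: coord_cauchy.
have lt : l \in small_tailsb by apply/asboolP; exact: limit_small_tails Fl.
apply/cvg_ex; exists (Space lt); apply/cvgrPdist_le => e e0.
move/cauchyP : Fc => /(_ (e / 2)) [|v Fv]; first by rewrite divr_gt0.
apply: filterS (Fv) => w; rewrite -ball_normE/= => vw.
rewrite -(subrKA v) (le_trans (ler_normD _ _))// [leRHS]splitr lerD ?(ltW vw)//.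
apply: norm_le => g n Gg; rewrite seq_ofB; exact: pairing_limit Fl Fv Gg.
Qed.

HB.instance Definition _ := Uniform_isComplete.Build space space_complete.

Lemma head_small_tails m x : head m x \in small_tailsb.
Proof.
apply/asboolP => d d0; exists m => g n p _ mn.
suff -> : head m x - head n (head m x) = 0 by rewrite pairing0r normr0 ltW.
apply/funext => j; rewrite !fctE /head.
case: (ltnP j m) => [jm|_]; last by rewrite if_same subr0.
by rewrite (leq_trans jm mn) subrr.
Qed.

(** * The unit vector basis *)

Definition truncation m x : space := Space (head_small_tails m x).

Definition unit_vector m : space := truncation m.+1 (delta m).

Lemma seq_of_unit_vector m : seq_of (unit_vector m) = delta m.
Proof.
apply/funext => j; rewrite /= /head; case: ltnP => // mj.
by rewrite /delta gtn_eqF.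
Qed.

Lemma seq_of_inj : injective seq_of. Proof. exact: val_inj. Qed.

Lemma sum_unit_vector x n :
  \sum_(j < n) x j *: unit_vector j = truncation n x.
Proof.
elim: n => [|n IH].
  rewrite big_ord0; apply/val_inj; rewrite raddf0.
  by apply/funext => j.
rewrite big_ord_recr/= IH; apply: seq_of_inj; rewrite seq_ofD seq_ofZ.
rewrite seq_of_unit_vector; apply/funext => j; rewrite !fctE /= /head /delta.
rewrite ltnS; case: ssrnat.ltngtP => [_|_|->]; rewrite ?scaler0 ?addr0 ?add0r//.
by rewrite /GRing.scale/= mulr1.
Qed.

Lemma series_unit_vector x n :
  series (fun j => x j *: unit_vector j) n = truncation n x.
Proof. by rewrite /series/= big_mkord sum_unit_vector. Qed.

Lemma truncation_cvg v : truncation n (seq_of v) @[n --> \oo] --> v.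
Proof.
apply/cvgrPdist_le => e e0; have [N hN] := small_tailsP v e0.
near=> n; apply: norm_le => g p Gg; rewrite seq_ofB/=; apply: hN => //.
by near: n; exact: nbhs_infty_ge.
Unshelve. all: by end_near. Qed.

Lemma unit_vector_basis : schauder_basis unit_vector.
Proof.
move=> v; exists (seq_of v); split.
  suff -> : series (fun j => seq_of v j *: unit_vector j) =
      truncation^~ (seq_of v) by exact: truncation_cvg.
  by apply/funext => n; exact: series_unit_vector.
(* Uniqueness: coordinates are continuous, and coordinate [j] of a partial sum is [x j] as soon as
   it has more than [j] terms. *)
move=> x /cvgrPdist_le xv; apply/funext => j; apply/eqP.
rewrite -subr_eq0 -normr_le0; apply/ler_addgt0Pr => e e0; rewrite add0r.
have /xv[N _ hN] : 0 < e / atom_bound K by rewrite divr_gt0// atom_bound_gt0.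
have := hN (maxn N j.+1) (leq_maxl _ _); rewrite /= series_unit_vector normE.
rewrite ler_pdivlMr ?atom_bound_gt0// mulrC; apply: le_trans.
apply: le_trans (coord_le_norm _ j); rewrite seq_ofB !fctE /= /head.
by rewrite leq_max ltnSn orbT.
Unshelve. all: by end_near. Qed.

(** By duality: writing [a = s b] on the first [N] coordinates, the multiplier [s] moves from the
    vector to the functional, which [k^-1] brings back into [polar]. *)
Lemma polar_multiplier_unconditional (k : R) : 0 < k ->
  (forall g (s : nat -> R^o), polar g -> (forall j, `|s j| <= 1) ->
    polar (k^-1 *: (fun j => s j * g j))) ->
  unconditional_basis k unit_vector.
Proof.
move=> k0 hk; split; first exact: unit_vector_basis.
move=> N a b ab; rewrite !sum_unit_vector !normE; apply: norm_le => g n Gg.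
(* If [b j = 0] then [a j = 0] as well, and division by zero gives 0. *)
pose s j : R := if (j < N)%N then a j / b j else 0.
have s1 j : `|s j| <= 1.
  rewrite /s; case: ifP => [jN|_]; last by rewrite normr0.
  have [bj0|bj0] := eqVneq (b j) 0; first by rewrite bj0 invr0 mulr0 normr0.
  by rewrite normf_div ler_pdivrMr ?normr_gt0// mul1r ab.
have := le_norm (truncation N b) n (hk g s Gg s1).
rewrite pairingZl normrM gtr0_norm ?invr_gt0// ler_pdivrMl//.
apply: le_trans; rewrite le_eqVlt; apply/orP; left; apply/eqP.
congr (`|_|); apply: eq_bigr => j _; rewrite /= /head /s.
case: ifP => [jN|_]; last by rewrite !mulr0.
have [bj0|bj0] := eqVneq (b j) 0; last by field.
have := ab j jN; rewrite bj0 normr0 normr_le0 => /eqP ->.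
by rewrite !mulr0.
Qed.

Lemma atom_norm_le1 u n : atom K u -> `|truncation n u| <= 1.
Proof.
move=> Ku; rewrite normE; apply: norm_le => g p Gg; rewrite /= pairing_headr.
exact: Gg.
Qed.

(** Otherwise [f] is at most [M] in absolute value on truncated atoms, by symmetry of the atoms. A
    multiple of [f] then lies in [polar], which bounds [f] on the ball by less than its supremum. *)
Lemma slice_meets_atoms (f : {linear space -> R^o}) (alpha : R) :
  (forall u, atom K u -> atom K (- u)) -> continuous f -> 0 < alpha ->
  exists u n, atom K u /\
    slice (@closed_unit_ball R space) f alpha (truncation n u).
Proof.
move=> Ksym cf a0; apply: contrapT => noatom.
set M := sup [set f v | v in @closed_unit_ball R space] - alpha.
have truncN u n : truncation n (- u) = - truncation n u.
  by apply: seq_of_inj; rewrite -[- truncation n u]scaleN1r seq_ofZ scaleN1r -headN.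
have fM u n : atom K u -> `|f (truncation n u)| <= M.
  have h x p : atom K x -> f (truncation p x) <= M.
    move=> Kx; rewrite leNgt; apply/negP => Mf; apply: noatom.
    by exists x, p; split=> //; split=> //; exact: atom_norm_le1.
  by move=> Ku; rewrite ler_norml lerNl -raddfN -truncN !h//; exact: Ksym.
have pf x n : pairing (fun j => f (unit_vector j)) x n = f (truncation n x).
  rewrite -sum_unit_vector linear_sum; apply: eq_bigr => j _.
  by rewrite linearZ /= mulrC.
have M0 : 0 <= M by apply: le_trans (fM (delta 0) 0%N (atom_delta K 0)).
(* Half of [alpha] keeps [c] positive even if [M = 0], and still below the supremum [M + alpha]. *)
pose c := M + alpha / 2.
have c0 : 0 < c by rewrite ltr_wpDl// divr_gt0.
have Gf : polar (c^-1 *: (fun j => f (unit_vector j))).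
  move=> u n Ku; rewrite pairingZl pf normrM gtr0_norm ?invr_gt0//.
  by rewrite ler_pdivrMl// mulr1 (le_trans (fM u n Ku))// lerDl ltW// divr_gt0.
have fc v : f v <= c * `|v|.
  have := cvg_comp _ _ (@truncation_cvg v) (cf v).
  move=> fv; apply: (cvgr_to_le fv); near=> n => /=; rewrite -pf.
  have := le_norm v n Gf; rewrite pairingZl normrM gtr0_norm ?invr_gt0//.
  by rewrite ler_pdivrMl//; apply: le_trans; exact: ler_norm.
suff : M + alpha <= c by rewrite /c; lra.
rewrite subrK; apply: ge_sup.
  by exists (f 0), 0 => //=; rewrite /closed_unit_ball/= normr0.
move=> _ [v v1 <-]; apply: le_trans (fc v) _.
by rewrite -[leRHS]mulr1 ler_wpM2l// ltW.
Unshelve. all: by end_near. Qed.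

End AtomicSpace.

(** * A tree on the natural numbers *)

(* The children of [t] are the numbers [2 ^ t * (2 * i + 1)]; the root 0 is its own
   parent, as [logn 2 0 = 0]. *)
Definition parent (n : nat) : nat := logn 2 n.

Definition ancestor (s t : nat) : Prop := exists i, s = iter i parent t.

Lemma parent_lt n : (0 < n)%N -> (parent n < n)%N.
Proof. exact: ltn_logl. Qed.

Lemma parent_le n : (parent n <= n)%N.
Proof. by case: n => [|n]; [rewrite /parent logn0|exact/ltnW/parent_lt]. Qed.

Lemma exists_child t N : exists2 c, (N < c)%N & parent c = t.
Proof.
(* The odd cofactor leaves the 2-adic valuation equal to [t] and makes the number exceed [N]. *)
exists (2 ^ t * N.*2.+1)%N.
  apply: (@leq_trans N.*2.+1); first by rewrite ltnS -addnn leq_addr.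
  by rewrite leq_pmull// expn_gt0.
rewrite /parent lognM ?expn_gt0// pfactorK// lognE/= dvdn2/= odd_double.
by rewrite addn0.
Qed.

Lemma ancestor_refl t : ancestor t t.
Proof. by exists 0%N. Qed.

Lemma ancestor_parent s t : ancestor s t <-> s = t \/ ancestor s (parent t).
Proof.
split=> [[[|i] ->]|[->|[i ->]]]; [by left| |exact: ancestor_refl|].
  by right; exists i; rewrite iterSr.
by exists i.+1; rewrite iterSr.
Qed.

Lemma ancestor_le s t : ancestor s t -> (s <= t)%N.
Proof.
case=> i ->; elim: i => //= i IH.
exact: leq_trans (parent_le _) IH.
Qed.

Lemma ancestor_total s1 s2 t : ancestor s1 t -> ancestor s2 t ->
  ancestor s1 s2 \/ ancestor s2 s1.
Proof.
move=> [i ->] [j ->]; case/orP: (leq_total i j) => ij; [right|left].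
  by exists (j - i)%N; rewrite -iterD subnK.
by exists (i - j)%N; rewrite -iterD subnK.
Qed.

(** * The atoms of the tree and unconditionality *)

Section TreeSpace.
Context {R : realType} (eps : R) (eps_gt0 : 0 < eps).
Implicit Types (u g : nat -> R^o) (t n : nat).

Definition below t j : bool := (0 < j)%N && `[< ancestor j t >].

Definition branch t : nat -> R^o := fun j => (below t j)%:R.

Definition node t : nat -> R^o := delta 0 + eps *: branch t.

(** Defined by domination, so that it is stable under multipliers bounded by 1. The condition
    [0 < j] excludes the root, which is its own parent. *)
Definition small u : Prop := exists t,
  (forall j, `|u j| <= (below t j)%:R) \/
  (forall j, `|u j| <= ((0 < j)%N && (parent j == t))%:R).

Definition tree_atom u : Prop :=
  [\/ small u, exists t, u = node t | exists t, u = - node t].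

Lemma below_child t c : (0 < c)%N -> parent c = t ->
  forall j, below c j = (j == c) || below t j.
Proof.
move=> c0 ct j; rewrite /below; apply/idP/idP.
  move=> /andP[j0 /asboolP/ancestor_parent[->|]]; first by rewrite eqxx.
  by rewrite ct j0/= => jt; apply/orP; right; apply/asboolP.
move=> /orP[/eqP ->|/andP[-> /asboolP jt]].
  by rewrite c0; apply/asboolP; exact: ancestor_refl.
by apply/asboolP/ancestor_parent; right; rewrite ct.
Qed.

Lemma below_le t j : below t j -> (j <= t)%N.
Proof. by move=> /andP[_ /asboolP/ancestor_le]. Qed.

Lemma branch_child t c : (0 < c)%N -> parent c = t ->
  branch c = branch t + delta c.
Proof.
move=> c0 ct; apply/funext => j; rewrite !fctE /branch /delta (below_child c0 ct).
have [->|] := eqVneq j c; rewrite ?addr0//=.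
case: (boolP (below t c)) => [/below_le|]; last by rewrite add0r.
by rewrite leqNgt -ct parent_lt.
Qed.

Lemma node_child t c : (0 < c)%N -> parent c = t ->
  node c = node t + eps *: delta c.
Proof. by move=> c0 ct; rewrite /node (branch_child c0 ct) scalerDr addrA. Qed.

Lemma branch0 : branch 0 = 0.
Proof.
apply/funext => j; rewrite /branch; case: (boolP (below 0 j)) => //.
by move=> /andP[j0 /asboolP/ancestor_le]; rewrite leqNgt j0.
Qed.

Lemma node0 : node 0 = delta 0.
Proof. by rewrite /node branch0 scaler0 addr0. Qed.

(** Indices increase along a branch, so truncation cuts the branch at its last node of index below
    [n]; nothing is left when [n = 0]. *)
Lemma head_node n t : head n (node t) = 0 \/
  exists s, head n (node t) = node s.
Proof.
elim/ltn_ind: t => t IH; case: (posnP t) => [->|t0].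
  rewrite node0 head_delta; case: ifP => _; last by left.
  by right; exists 0%N; rewrite node0.
rewrite (node_child t0 erefl) headD headZ head_delta; case: ifP => tn; last first.
  by rewrite scaler0 addr0; apply: IH; exact: parent_lt.
right; exists t; rewrite (node_child t0 erefl); congr (_ + _).
apply/funext => j; rewrite /head; case: ltnP => // nj.
have jt : (t < j)%N by exact: leq_trans nj.
rewrite /node /branch !fctE /delta gtn_eqF ?(leq_trans _ jt)// add0r.
case: (boolP (below _ j)) => [/below_le|_]; last by rewrite scaler0.
by rewrite leqNgt (leq_ltn_trans (parent_le t) jt).
Qed.

Lemma small_dominated u (w : nat -> R^o) :
  small u -> (forall j, `|w j| <= `|u j|) -> small w.
Proof.
by move=> [t [h|h]] wu; exists t; [left|right] => j; exact: le_trans (h j).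
Qed.

Lemma small_le1 u j : small u -> `|u j| <= 1.
Proof.
by move=> [t [] /(_ j)] /le_trans; apply; rewrite lern1 leq_b1.
Qed.

Lemma small0 u : small u -> u 0%N = 0.
Proof. by move=> [t [] /(_ 0%N)]/=; rewrite normr_le0 => /eqP. Qed.

Lemma small_zero : small 0.
Proof. by exists 0%N; left => j; rewrite normr0. Qed.

Lemma small_branch t : small (branch t).
Proof. by exists t; left => j; rewrite /branch normr_nat. Qed.

Lemma tree_atom_le u j : tree_atom u -> `|u j| <= 1 + eps.
Proof.
have h t : `|node t j| <= 1 + eps.
  rewrite /node /branch /delta (le_trans (ler_normD _ _))// lerD//.
    by case: eqP; rewrite ?normr1 ?normr0.
  rewrite normrM (gtr0_norm eps_gt0).
  by case: below; rewrite ?normr1 ?normr0 ?mulr1// mulr0 ltW.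
case=> [su|[t ->]|[t ->]]; [|exact: h|by rewrite !fctE normrN].
by rewrite (le_trans (small_le1 j su))// lerDl ltW.
Qed.

Lemma tree_atom_delta m : tree_atom (delta m).
Proof.
case: (posnP m) => [->|m0]; first by apply: Or32; exists 0%N; rewrite node0.
apply: Or31; exists m; left => j; rewrite /delta normr_nat.
have [->|//] := eqVneq j m.
by rewrite /below m0 asboolT//; exact: ancestor_refl.
Qed.

Lemma small_head n u : small u -> small (head n u).
Proof.
move=> su; apply: small_dominated su _ => j; rewrite /head.
by case: ifP => //; rewrite normr0.
Qed.

Lemma tree_atom_head u n : tree_atom u -> tree_atom (head n u).
Proof.
case=> [su|[t ->]|[t ->]].
- exact/Or31/small_head.
- have [->|[s ->]] := head_node n t; first exact/Or31/small_zero.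
  by apply: Or32; exists s.
- rewrite headN; have [->|[s ->]] := head_node n t.
    by rewrite oppr0; exact/Or31/small_zero.
  by apply: Or33; exists s.
Qed.

Definition tree_atoms : atoms R :=
  @Atoms R tree_atom (1 + eps) tree_atom_le tree_atom_delta tree_atom_head.

Lemma tree_atomN u : tree_atom u -> tree_atom (- u).
Proof.
case=> [su|[t ->]|[t ->]].
- by apply/Or31/small_dominated; [exact: su|move=> j; rewrite normrN].
- by apply: Or33; exists t.
- by apply: Or32; exists t; rewrite opprK.
Qed.

(** Small atoms stay small under [s]. A node vector is split into [delta 0] and [eps] times a
    branch, whose multiplied parts pair to at most 1 and [eps]. *)
Lemma tree_multiplier g (s : nat -> R^o) : polar tree_atoms g ->
  (forall j, `|s j| <= 1) ->
  polar tree_atoms ((1 + eps)^-1 *: (fun j => s j * g j)).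
Proof.
move=> Gg s1 u n Ku; have e0 : 0 < 1 + eps by rewrite addr_gt0.
rewrite pairingZl normrM gtr0_norm ?invr_gt0// ler_pdivrMl// mulr1 pairing_mull.
have hs w : small w -> `|pairing g (fun j => s j * w j) n| <= 1.
  move=> sw; apply: Gg; apply: Or31; apply: small_dominated sw _ => j.
  by rewrite normrM ler_piMl.
have hn t : `|pairing g (fun j => s j * node t j) n| <= 1 + eps.
  have -> : (fun j => s j * node t j) =
      s 0%N *: delta 0 + eps *: (fun j => s j * branch t j) :> (nat -> R^o).
    apply/funext => j; rewrite /node !fctE mulrDr; congr (_ + _); last first.
      by rewrite /GRing.scale/= mulrCA.
    by rewrite /delta /GRing.scale/=; have [->|] := eqVneq j 0%N; rewrite ?mulr0.
  rewrite pairingDr !pairingZr (le_trans (ler_normD _ _))// !normrM lerD//.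
    by rewrite -[leRHS]mulr1 ler_pM// Gg//; exact: tree_atom_delta.
  by rewrite (gtr0_norm eps_gt0) ler_piMr ?(ltW eps_gt0)// hs//; exact: small_branch.
case: Ku => [/hs h|[t ->]|[t ->]].
- by rewrite (le_trans h)// lerDl ltW.
- exact: hn.
- rewrite (_ : (fun j => _) = - (fun j => s j * node t j) :> (nat -> R^o)).
    by rewrite pairingNr normrN.
  by apply/funext => j; rewrite !fctE mulrN.
Qed.

Lemma tree_unconditional_basis :
  unconditional_basis (1 + eps) (@unit_vector R tree_atoms).
Proof.
apply: polar_multiplier_unconditional; first by rewrite addr_gt0.
by move=> g s; exact: tree_multiplier.
Qed.


(** * The unit ball is not SCD *)

Local Notation X := (space tree_atoms).
Local Notation ball1 := (closed_unit_ball X).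

Definition node_point t : X := truncation tree_atoms t.+1 (node t).

Lemma node_above t j : (t < j)%N -> node t j = 0.
Proof.
move=> tj; rewrite /node /branch !fctE /delta gtn_eqF ?(leq_trans _ tj)// add0r.
case: (boolP (below _ j)) => [/below_le|_]; last by rewrite scaler0.
by rewrite leqNgt tj.
Qed.

Lemma seq_of_node_point t : seq_of (node_point t) = node t.
Proof.
apply/funext => j; rewrite /= /head; case: ltnP => // tj.
by rewrite node_above.
Qed.

Lemma node_point_child t c : (0 < c)%N -> parent c = t ->
  node_point c = node_point t + eps *: unit_vector tree_atoms c.
Proof.
move=> c0 ct; apply: seq_of_inj; rewrite seq_ofD seq_ofZ !seq_of_node_point.
by rewrite seq_of_unit_vector (node_child c0 ct).
Qed.

Lemma node_point_ball t : ball1 (node_point t).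
Proof. by apply: atom_norm_le1; apply: Or32; exists t. Qed.

(* The children of [t] span a copy of c0, so [f] is small at all but finitely
   many of them. *)
Lemma slice_child (f : {linear X -> R^o}) (alpha : R) t N :
  continuous f -> slice ball1 f alpha (node_point t) ->
  exists c, [/\ (N < c)%N, parent c = t & slice ball1 f alpha (node_point c)].
Proof.
move=> cf [_]; rewrite -subr_gt0.
(* [d] is the margin by which [node_point t] lies in the slice; a child outside the slice must lose
   all of it through its term [eps *: unit_vector tree_atoms c]. *)
set M := sup _ - alpha; set d := _ - M => d0; apply: contrapT => nochild.
have child_le c : (N < c)%N -> parent c = t ->
    f (unit_vector tree_atoms c) <= - (d / eps).
  move=> Nc ct; rewrite -mulNr ler_pdivlMr// mulrC.
  rewrite leNgt; apply/negP => dc; apply: nochild; exists c; split=> //.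
  split; first exact: node_point_ball.
  rewrite (node_point_child _ ct) ?(leq_ltn_trans _ Nc)//.
  by rewrite linearD linearZ/= -ltrBlDl -opprB.
(* The indicator of the children of [t] beyond [N] has truncations in the unit ball, yet [f] drops
   by at least [d / eps] on them at each child. *)
pose u : nat -> R^o := fun j => ((N < j)%N && (parent j == t))%:R.
pose h n : R := f (truncation tree_atoms n u).
have hS n : h n.+1 = h n + u n * f (unit_vector tree_atoms n).
  by rewrite /h -!sum_unit_vector big_ord_recr linearD linearZ.
have de0 : 0 < d / eps by rewrite divr_gt0.
have hdec n : h n.+1 <= h n.
  rewrite hS gerDl /u; case: andP => [[Nn /eqP nt]|_]; last by rewrite mul0r.
  by rewrite mul1r (le_trans (child_le n Nn nt))// oppr_le0 ltW.
have hunb q : exists n, h n <= - (d / eps) *+ q.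
  elim: q => [|q [n IH]].
    by exists 0%N; rewrite /h -sum_unit_vector big_ord0 linear0.
  (* A child beyond [n] as well is not yet counted in [h n]. *)
  have [c nNc ct] := exists_child t (maxn n N); exists c.+1.
  move: nNc; rewrite gtn_max => /andP[nc Nc].
  rewrite hS mulrSr lerD//.
    apply: le_trans IH; apply: (nonincreasing_seqP h).1 => //; exact: ltnW.
  by rewrite /u Nc ct eqxx mul1r child_le.
have [r r0 fr] : exists2 r : R, 0 <= r & forall v : X, `|v| <= 1 -> `|f v| <= r.
  have /linear_boundedP[r [_ hr]] := continuous_linear_bounded 0 (cf 0).
  have r1 : r < `|r| + 1 by rewrite (le_lt_trans (ler_norm r))// ltrDl.
  exists (`|r| + 1) => [|v v1]; first by rewrite addr_ge0.
  by rewrite (le_trans (hr _ r1 v))// ler_piMr// addr_ge0.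
have [n hn] := hunb (Num.bound (r / (d / eps))).
have ball_u : `|truncation tree_atoms n u| <= 1.
  apply: atom_norm_le1; apply: Or31; exists t; right => j; rewrite /u normr_nat.
  by rewrite ler_nat; case: (ltnP N j) => // Nj; rewrite (leq_ltn_trans _ Nj).
have := fr _ ball_u; rewrite ler_norml => /andP[/le_trans/(_ hn) + _].
rewrite mulNrn lerN2 -mulr_natl -ler_pdivlMr// leNgt.
by rewrite archi_boundP// divr_ge0// ltW.
Qed.

(* The last two conditions make [A] an antichain of nodes with distinct
   parents. *)
Definition sparse (A : set nat) : Prop :=
  [/\ ~ A 0%N, forall a b, A a -> A b -> ancestor a b -> a = b &
      forall a b, A a -> A b -> parent a = parent b -> a = b].

Lemma sparse_bigcup (A_ : nat -> set nat) : (forall n, A_ n `<=` A_ n.+1) ->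
  (forall n, sparse (A_ n)) -> sparse (\bigcup_n A_ n).
Proof.
move=> AS sA.
have Amono m n : (m <= n)%N -> A_ m `<=` A_ n.
  by move=> /subnK <-; elim: (n - m)%N => // i IH; exact: subset_trans (AS _).
have common a b : (\bigcup_n A_ n) a -> (\bigcup_n A_ n) b ->
    exists n, A_ n a /\ A_ n b.
  move=> [m _ ma] [n _ nb]; exists (maxn m n).
  by split; [apply: Amono ma|apply: Amono nb]; rewrite ?leq_maxl ?leq_maxr.
split.
- by move=> [n _]; have [] := sA n.
- move=> a b /common/[apply] -[n [na nb]]; have [_ + _] := sA n; exact.
- move=> a b /common/[apply] -[n [na nb]]; have [_ _] := sA n; exact.
Qed.

(** At most one term is nonzero: an antichain meets a branch at most once, and nodes with distinct
    parents meet the children of one node at most once. *)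
Lemma pairing_sparse_small (A : set nat) u n : sparse A -> small u ->
  `|pairing (\1_A : nat -> R^o) u n| <= 1.
Proof.
move=> [A0 Aanc Apar] su.
have [[i iAu]|noi] := pselect (exists i : 'I_n, \1_A (val i) * u i != 0 :> R).
  rewrite /pairing (bigD1 i)//= big1 ?addr0 => [|j ji].
    rewrite normrM mulr_ile1 ?normr_ge0//; last exact: small_le1.
    by rewrite indicE normr_nat lern1 leq_b1.
  apply: contraNeq ji => jAu; apply/eqP/val_inj => /=.
  move: iAu jAu; rewrite !indicE !mulf_eq0 !negb_or !pnatr_eq0 !eqb0 !negbK.
  move=> /andP[/set_mem Ai ui] /andP[/set_mem Aj uj].
  have uP (P : nat -> bool) k : (forall j, `|u j| <= (P j)%:R) -> u k != 0 -> P k.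
    move=> /(_ k); case: (P k) => //; rewrite normr_le0 => /eqP ->.
    by rewrite eqxx.
  case: su => t [/uP h|/uP h].
    have /andP[_ /asboolP it] := h _ ui; have /andP[_ /asboolP jt] := h _ uj.
    case: (ancestor_total it jt) => [ij|ji]; last exact: Aanc.
    by apply/esym; exact: Aanc.
  have /andP[_ /eqP it] := h _ ui; have /andP[_ /eqP jt] := h _ uj.
  by apply: Apar; rewrite // it jt.
rewrite /pairing big1 ?normr0// => j _; apply/eqP/negP => jAu; apply: noi.
by exists j; apply/negP.
Qed.

(** * The separating functional *)

Definition separator (A : set nat) : nat -> R^o :=
  (\1_A : nat -> R^o) - (1 + eps) *: delta 0.

Lemma pairing_separator A u n : pairing (separator A) u n =
  pairing (\1_A : nat -> R^o) u n - (1 + eps) * (if (0 < n)%N then u 0%N else 0).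
Proof.
rewrite -pairing_deltal -pairingZl /pairing -sumrB; apply: eq_bigr => j _.
by rewrite -mulrBl.
Qed.

Lemma pairing_sparse_node A t n : sparse A ->
  pairing (\1_A : nat -> R^o) (node t) n =
  eps * pairing (\1_A : nat -> R^o) (branch t) n.
Proof.
move=> [A0 _ _]; rewrite /node pairingDr pairingZr.
by rewrite pairing_deltar indicE memNset// if_same add0r.
Qed.

(** This is the continuity of the separator. On a node vector its two parts are at most [eps] and
    [1 + eps], whence the factor [2 * (1 + eps)]. *)
Lemma polar_separator A : sparse A ->
  polar tree_atoms ((2 * (1 + eps))^-1 *: separator A).
Proof.
move=> sA u n Ku; have e0 : 0 < 1 + eps by rewrite addr_gt0.
have e20 : 0 < 2 * (1 + eps) by rewrite mulr_gt0.
rewrite pairingZl normrM gtr0_norm ?invr_gt0// ler_pdivrMl// mulr1.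
rewrite mulrDl mul1r.
have hn t : `|pairing (separator A) (node t) n| <= 1 + eps + (1 + eps).
  rewrite pairing_separator (le_trans (ler_normB _ _))// lerD//.
    rewrite pairing_sparse_node// normrM (gtr0_norm eps_gt0).
    rewrite (@le_trans _ _ eps)// ?ler_wpDl//.
    by rewrite ler_piMr ?(ltW eps_gt0)// pairing_sparse_small//; exact: small_branch.
  rewrite normrM (gtr0_norm e0) ler_piMr ?(ltW e0)//.
  case: ifP => _; rewrite ?normr0//.
  by rewrite /node /branch /delta !fctE /= scaler0 addr0 normr1.
case: Ku => [su|[t ->]|[t ->]].
- rewrite pairing_separator small0// if_same mulr0 subr0.
  rewrite (le_trans (pairing_sparse_small n sA su))//.
  by have := eps_gt0; lra.
- by apply: le_trans (hn t) _; have := eps_gt0; lra.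
- by rewrite pairingNr normrN; apply: le_trans (hn t) _; have := eps_gt0; lra.
Qed.

(** The vectors on which the separator stays at least -1, also after [A] is enlarged to another
    sparse set. *)
Definition avoids (A : set nat) (u : nat -> R^o) : Prop :=
  [\/ small u, exists t, u = - node t |
      exists t, u = node t /\ exists2 a, A a & ancestor a t].

Lemma avoids_subset (A A' : set nat) u : A `<=` A' -> avoids A u -> avoids A' u.
Proof.
move=> AA' [su|[t ut]|[t [ut [a Aa at_]]]]; first exact: Or31.
  by apply: Or32; exists t.
by apply: Or33; exists t; split=> //; exists a => //; exact: AA'.
Qed.

(** A node of [A] on the branch contributes [eps], which lifts [- (1 + eps)] to -1; on the opposite
    of a node vector the value is at least [1 + eps - eps]. Partial sums must first reach the
    coordinates involved, whence [N]. *)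
Lemma avoids_separator A u : sparse A -> avoids A u ->
  exists N, forall n, (N <= n)%N -> -1 <= pairing (separator A) u n.
Proof.
move=> sA; have hb t n : pairing (\1_A : nat -> R^o) (branch t) n <= 1.
  by apply: le_trans (pairing_sparse_small n sA (small_branch t)); exact: ler_norm.
have n0 t : node t 0%N = 1.
  by rewrite /node /branch /delta !fctE /= scaler0 addr0.
case=> [su|[t ->]|[t [-> [a Aa at_]]]].
- exists 0%N => n _; rewrite pairing_separator small0// if_same mulr0 subr0.
  by have := pairing_sparse_small n sA su; rewrite ler_norml => /andP[].
- exists 1%N => n n1; rewrite pairingNr pairing_separator pairing_sparse_node//.
  rewrite n1 n0 lerN2; have := ler_wpM2l (ltW eps_gt0) (hb t n).
  by have := eps_gt0; lra.
- exists t.+1 => n tn; rewrite pairing_separator pairing_sparse_node//.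
  rewrite (leq_trans _ tn)// n0 mulr1.
  suff h1 : 1 <= pairing (\1_A : nat -> R^o) (branch t) n.
    by have := ler_wpM2l (ltW eps_gt0) h1; lra.
  have an : (a < n)%N by rewrite (leq_trans _ tn)// ltnS ancestor_le.
  have a0 : (0 < a)%N by case: (posnP a) Aa => // ->; have [] := sA.
  rewrite /pairing (bigD1 (Ordinal an))//= indicE mem_set// mul1r.
  by rewrite /branch /below a0 asboolT// lerDl sumr_ge0.
Qed.

(** A child [c] might share its parent with a member of [A], which is why a grandchild [a] is added:
    nodes with parent [c] have index above [N], so none is in [A]. Nor is [a] an ancestor of a
    member of [A], its index being too large. *)
Lemma sparse_extend (A : set nat) N c a :
  sparse A -> (forall b, A b -> (b <= N)%N) -> (N < c)%N -> (c < a)%N ->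
  parent a = c -> (forall b, A b -> ~ ancestor b (parent c)) ->
  sparse (a |` A).
Proof.
move=> [A0 Aanc Apar] AN Nc ca ac Ac.
have Aa b : A b -> (b < a)%N by move=> /AN/leq_ltn_trans/(_ Nc)/ltn_trans; exact.
split.
- by case=> // a0; move: ca; rewrite -a0.
- move=> x y [->|Ax] [->|Ay]//; last exact: Aanc.
    by move=> /ancestor_le; rewrite leqNgt Aa.
  move=> /ancestor_parent[//|]; rewrite ac => /ancestor_parent[xc|xc].
    by have := AN _ Ax; rewrite xc leqNgt Nc.
  by have := Ac _ Ax xc.
- move=> x y [->|Ax] [->|Ay]//; last exact: Apar.
    rewrite ac => cy; have := AN _ Ay; rewrite leqNgt.
    by rewrite (leq_trans Nc)// cy parent_le.
  rewrite ac => cx; have := AN _ Ax; rewrite leqNgt.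
  by rewrite (leq_trans Nc)// -cx parent_le.
Qed.

Lemma select_in_slice (S : set X) (A : set nat) :
  is_slice ball1 S -> sparse A -> (exists N, forall b, A b -> (b <= N)%N) ->
  exists (A' : set nat) (x : X),
    [/\ A `<=` A', sparse A', exists N, forall b, A' b -> (b <= N)%N,
        S x & avoids A' (seq_of x)].
Proof.
move=> [_ [f [alpha [cf _ a0 ->]]]] sA [N AN].
have [u [n [Ku Su]]] := @slice_meets_atoms R tree_atoms f alpha tree_atomN cf a0.
have keep x : slice ball1 f alpha x -> avoids A (seq_of x) ->
    exists (A' : set nat) (x : X),
    [/\ A `<=` A', sparse A', exists N, forall b, A' b -> (b <= N)%N,
        slice ball1 f alpha x & avoids A' (seq_of x)].
  by move=> Sx Ax; exists A, x; split=> //; exists N.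
have : tree_atom (seq_of (truncation tree_atoms n u)) by exact: tree_atom_head.
case=> [su|[t ut]|nu]; [exact/(keep _ Su)/Or31| |exact/(keep _ Su)/Or32].
have [tA|tA] := pselect (exists2 a, A a & ancestor a t).
  by apply: keep Su _; apply: Or33; exists t.
have St : slice ball1 f alpha (node_point t).
  suff -> : node_point t = truncation tree_atoms n u by [].
  by apply: seq_of_inj; rewrite ut seq_of_node_point.
(* Two descents inside the slice: the child goes beyond the bound [N] of [A], the grandchild beyond
   the child. *)
have [c [Nc ct Sc]] := slice_child N cf St.
have [a [ca ac Sa]] := slice_child c cf Sc.
exists (a |` A), (node_point a); split=> //.
- apply: (sparse_extend sA AN Nc ca ac) => b Ab; rewrite ct => bt.
  by apply: tA; exists b.
- by exists a => b [->//|/AN bN]; rewrite (leq_trans bN)// ltnW// (ltn_trans Nc).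
- apply: Or33; exists a; rewrite seq_of_node_point; split=> //.
  by exists a; [left|exact: ancestor_refl].
Qed.

Lemma avoiding_selection (S_ : nat -> set X) :
  (forall n, is_slice ball1 (S_ n)) ->
  exists (A : set nat) (x_ : nat -> X),
    sparse A /\ forall n, S_ n (x_ n) /\ avoids A (seq_of (x_ n)).
Proof.
move=> sS; pose good A := sparse A /\ exists N, forall b, A b -> (b <= N)%N.
(* The choice function is total; pairs whose set is not [good] get a dummy value. *)
have /choice[F hF] (p : nat * set nat) : exists q : set nat * X, good p.2 ->
    [/\ p.2 `<=` q.1, good q.1, S_ p.1 q.2 & avoids q.1 (seq_of q.2)].
  case: p => n A; have [[sA AN]|ngA] := pselect (good A); last by exists (A, 0).
  have [A' [x [AA' sA' A'N Sx Ax]]] := select_in_slice (sS n) sA AN.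
  by exists (A', x).
(* [A_ n] is the set before the n-th slice is treated, so the n-th vector avoids [A_ n.+1]. *)
pose A_ := fix A_ n := if n is n'.+1 then (F (n', A_ n')).1 else set0.
have gA n : good (A_ n).
  by elim: n => [|n IH]; [split; [split|exists 0%N]|have [] := hF (n, A_ n) IH].
have step n := hF (n, A_ n) (gA n).
exists (\bigcup_n A_ n), (fun n => (F (n, A_ n)).2); split.
  by apply: sparse_bigcup => n; [have [] := step n|have [] := gA n].
move=> n; have [_ _ Sx Ax] := step n; split=> //.
by apply: avoids_subset Ax => b Ab; exists n.+1.
Qed.

(** Asking for the inequality eventually replaces the limit of the pairings; the larger of two
    thresholds serves for a convex combination. *)
Lemma separated_half_space_convex (g : nat -> R^o) (c : R) :
  convex_set [set v : X | exists N, forall n, (N <= n)%N ->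
    c <= pairing g (seq_of v) n].
Proof.
move=> x y l /set_mem[N1 h1] /set_mem[N2 h2]; apply/mem_set.
exists (maxn N1 N2) => n; rewrite geq_max => /andP[/h1 {}h1 /h2 {}h2].
rewrite seq_ofD !seq_ofZ pairingDr !pairingZr.
have l0 : 0 <= l%:num by [].
have l1 : 0 <= unstable.onem l%:num by rewrite subr_ge0.
apply: le_trans (lerD (ler_wpM2l l0 h1) (ler_wpM2l l1 h2)).
by rewrite -mulrDl unstable.add_onemK mul1r.
Qed.

Theorem tree_ball_not_SCD : ~ SCD ball1.
Proof.
move=> [S_ [sS hS]].
have [A [x_ [sA hx]]] := avoiding_selection sS.
pose H := [set v : X | exists N, forall n, (N <= n)%N ->
  -1 <= pairing (separator A) (seq_of v) n].
have xH : range x_ `<=` H.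
  by move=> _ [n _ <-]; apply: avoids_separator => //; have [] := hx n.
have xball : range x_ `<=` ball1.
  move=> _ [n _ <-]; have [Sx _] := hx n.
  by have [_ [f [alpha [_ _ _ Sn]]]] := sS n; move: Sx; rewrite Sn => -[].
have xS n : range x_ `&` S_ n !=set0.
  by exists (x_ n); split; [exists n|have [] := hx n].
pose C := 2 * (1 + eps).
have C0 : 0 < C by rewrite mulr_gt0// addr_gt0.
(* The point [node_point 0] is the unit vector at the root. The separator has norm at most [C], so a
   point [y] of the hull within [eps / C] gives values differing by less than [eps], whereas -1 and
   [- (1 + eps)] differ by [eps]. *)
have := hS _ xball xS _ (node_point_ball 0).
move=> /(_ _ (nbhsx_ballx (node_point 0) (eps / C) _)).
case=> [|y [yhull]]; first by rewrite divr_gt0.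
have [N hN] : H y.
  by apply: yhull; split => //; exact: separated_half_space_convex.
rewrite -ball_normE/= distrC ltr_pdivlMr// mulrC ltNge => /negP; apply.
(* The index must be at least 1 for the root coordinate to be counted. *)
have := hN (maxn N 1) (leq_maxl _ _).
have := le_norm (y - node_point 0) (maxn N 1) (polar_separator sA).
rewrite pairingZl normrM gtr0_norm ?invr_gt0// ler_pdivrMl//.
move/(le_trans (ler_norm _)) => + hy; apply: le_trans.
rewrite seq_ofB pairingBr seq_of_node_point [X in _ - X]pairing_separator.
rewrite pairing_sparse_node// branch0 pairing0r leq_max orbT node0 /delta eqxx.
by rewrite mulr0 sub0r opprK mulr1 addrA -lerBlDr subrr -lerBlDr sub0r.
Qed.

End TreeSpace.

Theorem theorem6p3 (R : realType) (k : R) (hk : 1 < k) :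
  exists (X : completeNormedModType R) (e : nat -> X),
    unconditional_basis k e /\ ~ SCD (closed_unit_ball X).
Proof.
have eps_gt0 : 0 < k - 1 by rewrite subr_gt0.
exists (space (tree_atoms eps_gt0)), (@unit_vector R (tree_atoms eps_gt0)).
split; last exact: tree_ball_not_SCD.
have kE : 1 + (k - 1) = k by rewrite addrC subrK.
have := tree_unconditional_basis eps_gt0.
by rewrite [X in unconditional_basis X]kE.
Qed.
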